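(* Let $f \colon \mathbb{R}^n \to \mathbb{R}$ be a $C^1$ semialgebraic function, let $t \in \mathbb{R}$, and let $V_t := \{x \in \mathbb{R}^n : f(x) = t\}$. Assume that $t \notin K_\infty(f)$, where $K_\infty(f)$ is the set of asymptotic critical values of $f$. Then there exist constants $\alpha > 0$ and $c > 0$ such that $$|f(x) - t|^{\alpha} + \|x\|\,|f(x) - t| \ \ge\ c\, \mathrm{dist}(x, V_t) \quad \text{for all } x \in \mathbb{R}^n.$$
   Context: A function $f \colon \mathbb{R}^n \to \mathbb{R}$ is semialgebraic if its graph is a semialgebraic subset of $\mathbb{R}^{n+1}$. The norm $\|\cdot\|$ is the Euclidean norm. For $A \subset \mathbb{R}^n$ and $x \in \mathbb{R}^n$, $\mathrm{dist}(x, A)$ denotes the Euclidean distance from $x$ to $A$, with the convention $\mathrm{dist}(x, \emptyset) = 1$. The set of asymptotic critical values of a $C^1$ function $f \colon \mathbb{R}^n \to \mathbb{R}$ is $$K_\infty(f) := \{ y \in \mathbb{R} \mid \text{there exists a sequence } x^k \in \mathbb{R}^n \text{ such that } \|x^k\| \to +\infty,\ f(x^k) \to y,\ \|x^k\|\,\|\nabla f(x^k)\| \to 0 \}.$$ *)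

(* Defs.v *)
From HB Require Import structures.
From mathcomp Require Import all_boot all_order all_algebra.
From mathcomp Require mpoly.
From mathcomp Require Import all_classical all_reals all_analysis.

Set Implicit Arguments.
Unset Strict Implicit.
Unset Printing Implicit Defensive.

Import Order.TTheory GRing.Theory Num.Theory.
Import numFieldNormedType.Exports.

Local Open Scope classical_set_scope.
Local Open Scope ring_scope.

(* The library's norm `|x| on 'rV[R]_n is the sup norm. *)
Definition enorm (R : realType) (n : nat) (x : 'rV[R]_n) : R :=
  Num.sqrt (\sum_(i < n) x 0 i ^+ 2).

(* By convention the distance to the empty set is 1; the library's inf would
   give 0. *)
Definition dist_to (R : realType) (n : nat) (x : 'rV[R]_n)
    (A : set 'rV[R]_n) : R :=
  if `[< A !=set0 >] then inf [set enorm (x - a) | a in A] else 1.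

(* Evaluation at the coordinates of a row vector; mpoly is not imported because
   its notations clash with those of MathComp-Analysis. *)
Definition peval (R : realType) (m : nat) (p : mpoly.mpoly m R)
    (x : 'rV[R]_m) : R :=
  mpoly.meval (fun i => x 0 i) p.

Definition semialgebraic (R : realType) (m : nat) (A : set 'rV[R]_m) : Prop :=
  exists s : seq (seq (mpoly.mpoly m R) * seq (mpoly.mpoly m R)),
    A = [set x | has (fun c => all (fun p => peval p x == 0) c.1 &&
                               all (fun q => 0 < peval q x) c.2) s].

(* R^n x R is identified with R^(n+1), the value being the last coordinate. *)
Definition semialgebraic_fun (R : realType) (n : nat)
    (f : 'rV[R]_n -> R) : Prop :=
  semialgebraic [set z : 'rV[R]_(n + 1) | f (lsubmx z) = rsubmx z 0 0].

Definition gradient (R : realType) (n : nat) (f : 'rV[R]_n -> R)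
    (x : 'rV[R]_n) : 'rV[R]_n :=
  \row_(i < n) 'D_(delta_mx 0 i) f x.

Definition C1 (R : realType) (n : nat) (f : 'rV[R]_n -> R) : Prop :=
  (forall x : 'rV[R]_n, differentiable f x) /\ continuous (gradient f).

Definition asymptotic_critical_values (R : realType) (n : nat)
    (f : 'rV[R]_n -> R) : set R :=
  [set y | exists u : nat -> 'rV[R]_n,
    [/\ enorm (u k) @[k --> \oo] --> +oo,
        f (u k) @[k --> \oo] --> y &
        enorm (u k) * enorm (gradient f (u k)) @[k --> \oo] --> 0]].

(* Main.v *)
Require Import Defs.
From mathcomp Require Import all_boot all_order all_algebra.
From mathcomp Require Import all_classical all_reals all_analysis.
From mathcomp Require Import ring lra.
From mathcomp Require mpoly polyrcf ordered_qelim qe_rcf.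

(** Outside a large ball the hypothesis on t bounds ||x|| ||grad f(x)|| from
below on the strip |f - t| <= d.  For such an x, minimise
|f - t| + lambda ||. - x|| over the ball of radius ||x||/2 around x, with lambda
slightly below the gradient bound: a minimiser off V_t could be improved along
the gradient, so it lies in V_t, and dist(x, V_t) = O(||x|| |f(x) - t|).

Inside the large ball one needs a Lojasiewicz inequality.  The set of pairs
(r, y) such that |f(x) - t| = y for some x of the ball at distance at least r
from V_t is definable, so by quantifier elimination it is cut out by sign
conditions on finitely many polynomials p(r, y).  By compactness it avoids small
y > 0 for each r > 0, hence each of its points has below it a root y' of some
nonzero p(r, .), and positive roots satisfy y' >= c r^N near r = 0. *)

Import Order.TTheory GRing.Theory Num.Theory.
Import numFieldNormedType.Exports.

Local Open Scope classical_set_scope.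
Local Open Scope ring_scope.

Set Implicit Arguments.
Unset Strict Implicit.
Unset Printing Implicit Defensive.

(** * Growth of the positive roots of bivariate polynomials as r tends to 0 *)

Section RootGrowth.
Variable R : rcfType.
Implicit Types (p : {poly {poly R}}) (q : {poly R}) (r y : R).

Lemma poly_bounded01 q :
  exists2 C, 0 < C & forall r, 0 <= r <= 1 -> `|q.[r]| <= C.
Proof.
elim/poly_ind: q => [|q a [C C0 HC]].
  by exists 1 => // r _; rewrite horner0 normr0.
exists (C + `|a|); first by rewrite ltr_pwDl.
move=> r /[dup] /HC Hr /andP[r0 r1].
rewrite hornerMXaddC (le_trans (ler_normD _ _))// lerD2r normrM.
by rewrite (le_trans _ Hr)// ler_piMr// ger0_norm.
Qed.

Lemma poly2_bounded01 p :
  exists2 C, 0 < C & forall r y, 0 <= r <= 1 -> 0 <= y <= 1 ->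
    `|p.[y%:P].[r]| <= C.
Proof.
elim/poly_ind: p => [|p a [C C0 HC]].
  by exists 1 => // r y _ _; rewrite !horner0 normr0.
have [D D0 HD] := poly_bounded01 a.
exists (C + D); first by rewrite addr_gt0.
move=> r y r01 /[dup] y01 /andP[y0 y1].
rewrite hornerMXaddC hornerD hornerM hornerC.
rewrite (le_trans (ler_normD _ _))// lerD ?HD// normrM.
by rewrite (le_trans _ (HC r y r01 y01))// ler_piMr// ger0_norm.
Qed.

(** Dividing [q] by the largest power X^N that divides it leaves a nonzero constant term, which
    dominates the other terms near 0. *)
Lemma poly_lower_bound q : q != 0 ->
  exists (r0 c : R) (N : nat), [/\ 0 < r0 <= 1, 0 < c &
    forall r, 0 < r <= r0 -> c * r ^+ N <= `|q.[r]|].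
Proof.
elim/poly_ind: q => [|q a IH]; first by rewrite eqxx.
have [->|a0 _] := eqVneq a 0.
  rewrite polyC0 addr0 => qX0.
  have [|r0 [c [N [r00 c0 H]]]] := IH.
    by apply: contra_neq qX0 => ->; rewrite mul0r.
  exists r0, c, N.+1; split=> // r /[dup] /H Hr /andP[rgt0 _].
  by rewrite hornerMX normrM exprSr mulrA (gtr0_norm rgt0) ler_wpM2r// ltW.
have [C C0 HC] := poly_bounded01 q.
have a1 : 0 < `|a| by rewrite normr_gt0.
(* This radius keeps [|q.[r] * r|] at most [|a| / 2], where [C] bounds [q] on [0, 1]. *)
exists (Num.min 1 (`|a| / 2 / C)), (`|a| / 2), 0%N; split.
- by rewrite lt_min ltr01 !divr_gt0//= ge_min lexx.
- by rewrite divr_gt0.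
move=> r /andP[r0]; rewrite le_min ler_pdivlMr// => /andP[r1 rC].
rewrite expr0 mulr1 hornerMXaddC.
have qr : `|q.[r]| <= C by apply: HC; rewrite r1 ltW.
have : `|q.[r] * r| <= `|a| / 2.
  by rewrite normrM (gtr0_norm r0) mulrC (le_trans _ rC)// ler_wpM2l// ltW.
have : `|a| <= `|q.[r] * r + a| + `|q.[r] * r|.
  by rewrite -{1}(addKr (q.[r] * r) a) addrC (le_trans (ler_normB _ _)).
move: (`|q.[r] * r + a|) (`|q.[r] * r|) (`|a|) => u v w; lra.
Qed.

(** Positive roots y survive division by the outer ['X], so the part a(r) free of y may be taken
    nonzero. The equation then reads a(r) = - y p(r, y), with p now the remaining quotient, which is
    bounded on the unit square; so y is at least a multiple of |a(r)|. *)
Lemma root2_lower_bound p : p != 0 ->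
  exists (r0 c : R) (N : nat), [/\ 0 < r0 <= 1, 0 < c &
    forall r y, 0 < r <= r0 -> 0 < y -> p.[y%:P].[r] = 0 -> c * r ^+ N <= y].
Proof.
elim/poly_ind: p => [|p a IH]; first by rewrite eqxx.
have [->|a0 _] := eqVneq a 0.
  rewrite polyC0 addr0 => pX0.
  have [|r0 [c [N [r00 c0 H]]]] := IH.
    by apply: contra_neq pX0 => ->; rewrite mul0r.
  exists r0, c, N; split=> // r y rr0 y0 /eqP.
  rewrite hornerMX hornerM hornerC mulf_eq0 (gt_eqF y0) orbF => /eqP.
  exact: H.
have [C C0 HC] := poly2_bounded01 p.
have [r0 [c [N [/andP[r00 r01] c0 H]]]] := poly_lower_bound a0.
(* The minimum with 1 covers the roots y >= 1, since r^N <= 1. *)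
exists r0, (Num.min 1 (c / C)), N; split; first by rewrite r00.
  by rewrite lt_min ltr01 divr_gt0.
move=> r y /[dup] rr0 /andP[rgt0 rle] y0.
have r1 : r <= 1 by rewrite (le_trans rle).
have rN0 : 0 <= r ^+ N by rewrite exprn_ge0// ltW.
rewrite hornerMXaddC hornerD hornerM hornerC => /eqP.
rewrite addr_eq0 => /eqP pya.
have [y1|/ltW y1] := leP y 1; last first.
  rewrite (le_trans _ y1)// -[leRHS]mul1r ler_pM//.
  - by rewrite le_min ler01 divr_ge0// ltW.
  - by rewrite ge_min lexx.
  - by rewrite exprn_ile1// ltW.
have : c * r ^+ N <= C * y.
  rewrite (le_trans (H _ rr0))// -normrN -pya normrM (gtr0_norm y0).
  by rewrite ler_wpM2r ?(ltW y0)// HC ?r1 ?y1 ?ltW.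
rewrite -ler_pdivrMl// => {}H; apply: le_trans H.
by rewrite mulrA [C^-1 * c]mulrC ler_wpM2r// ge_min lexx orbT.
Qed.

Lemma roots2_lower_bound (s : seq {poly {poly R}}) :
  exists (r0 c : R) (N : nat), [/\ 0 < r0 <= 1, 0 < c &
    forall p r y, p \in s -> p != 0 -> 0 < r <= r0 -> 0 < y ->
      p.[y%:P].[r] = 0 -> c * r ^+ N <= y].
Proof.
elim: s => [|p s [r1 [c1 [N1 [/andP[r10 r11] c10 H1]]]]].
  by exists 1, 1, 0%N; rewrite ltr01 lexx.
have [->|/root2_lower_bound[r2 [c2 [N2 [/andP[r20 r21] c20 H2]]]]] :=
  eqVneq p 0.
  exists r1, c1, N1; split=> //; first by rewrite r10.
  by move=> q r y; rewrite inE => /predU1P[->|qs]; [rewrite eqxx|exact: H1].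
exists (Num.min r1 r2), (Num.min c1 c2), (maxn N1 N2); split.
- by rewrite lt_min r10 r20 ge_min r11.
- by rewrite lt_min c10.
move=> q r y qs q0 /andP[r0]; rewrite le_min => /andP[rr1 rr2] y0 qyr.
(* As r <= 1, lowering the constant and raising the exponent weakens the bound, so one pair serves
   the whole list. *)
have aux c N : Num.min c1 c2 <= c -> (N <= maxn N1 N2)%N -> c * r ^+ N <= y ->
    Num.min c1 c2 * r ^+ maxn N1 N2 <= y.
  move=> cc NN; apply: le_trans; rewrite ler_pM//.
  - by rewrite le_min !ltW.
  - by rewrite exprn_ge0// ltW.
  - by rewrite ler_wiXn2l// ?(ltW r0)// (le_trans rr1).
move: qs; rewrite inE => /predU1P[qp|qs].
  apply: (aux c2 N2); rewrite ?ge_min ?lexx ?orbT ?leq_maxr//.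
  by apply: H2; rewrite ?r0// -qp.
apply: (aux c1 N1); rewrite ?ge_min ?lexx ?leq_maxl//.
by apply: (H1 q); rewrite ?r0.
Qed.

(** Specialising r in the coefficients gives a univariate polynomial in y, to which the intermediate
    value theorem applies. *)
Lemma horner2_map p r y : p.[y%:P].[r] = (map_poly (horner_eval r) p).[y].
Proof.
by rewrite -[in LHS]/(horner_eval r _) -horner_map/= /horner_eval hornerC.
Qed.

(** A change of sign would force a root between y and y'. The zero polynomial has constant sign 0,
    so roots are excluded only for p != 0. *)
Lemma sgr_poly2_constant p r y y' : y <= y' ->
  (p != 0 -> forall z, y <= z <= y' -> p.[z%:P].[r] != 0) ->
  Num.sg p.[y%:P].[r] = Num.sg p.[y'%:P].[r].
Proof.
move=> yy' H; have [->|p0] := eqVneq p 0; first by rewrite !horner0.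
have {p0} := H p0; rewrite !horner2_map; set q := map_poly _ p => {}H.
apply/eqP; rewrite eq_sym; apply/negPn/negP => sg_neq.
have [|x] := @polyrcf.poly_ivt _ q y y' yy'; last first.
  rewrite in_itv/= => /H; rewrite horner2_map -/q => qx /rootP qx0.
  by rewrite qx0 eqxx in qx.
rewrite leNgt; apply: contra sg_neq.
case: (ltgtP 0 q.[y]) => [yp|yn|<-]; last by rewrite mul0r ltxx.
- by rewrite pmulr_rgt0// => y'p; rewrite !gtr0_sg.
- by rewrite nmulr_rgt0// => y'n; rewrite !ltr0_sg.
Qed.

End RootGrowth.

(** * Quantifier elimination and definable sets in the (r, y)-plane *)

Section FormulaGrowth.
Import GRing ordered_qelim ordered_qelim.ord.
Variable R : rcfType.
Implicit Types (r y : R) (t : term R) (f : ord.formula R).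

(* Variable 0 becomes the inner indeterminate r, variable 1 the outer one y;
   inverses get a junk value, as only [rterm]s are translated faithfully. *)
Fixpoint term_poly2 t : {poly {poly R}} :=
  match t with
  | GRing.Var 0 => ('X)%:P
  | GRing.Var 1 => 'X
  | GRing.Var _ => 0
  | GRing.Const x => x%:P%:P
  | GRing.NatConst n => n%:R
  | GRing.Add t1 t2 => term_poly2 t1 + term_poly2 t2
  | GRing.Opp t1 => - term_poly2 t1
  | GRing.NatMul t1 n => term_poly2 t1 *+ n
  | GRing.Mul t1 t2 => term_poly2 t1 * term_poly2 t2
  | GRing.Inv _ => 0
  | GRing.Exp t1 n => term_poly2 t1 ^+ n
  end.

Lemma term_poly2E r y t : rterm t ->
  (term_poly2 t).[y%:P].[r] = eval [:: r; y] t.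
Proof.
elim: t => //=.
- by case=> [|[|i]] _; rewrite !(hornerX, hornerC, horner0)/= ?nth_nil.
- by move=> x _; rewrite !hornerC.
- by move=> n _; rewrite !(hornerMn, hornerC).
- by move=> t1 IH1 t2 IH2 /andP[/IH1 <- /IH2 <-]; rewrite !hornerD.
- by move=> t1 IH1 /IH1 <-; rewrite !hornerN.
- by move=> t1 IH1 n /IH1 <-; rewrite !hornerMn.
- by move=> t1 IH1 t2 IH2 /andP[/IH1 <- /IH2 <-]; rewrite !hornerM.
- by move=> t1 IH1 n /IH1 <-; rewrite !horner_exp.
Qed.

(** The truth of a comparison depends only on the sign of the difference of its sides, so one
    polynomial serves all three relations. *)
Fixpoint atoms f : seq {poly {poly R}} :=
  match f with
  | ord.Equal t1 t2 | ord.Lt t1 t2 | ord.Le t1 t2 =>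
      [:: term_poly2 t1 - term_poly2 t2]
  | ord.And f1 f2 | ord.Or f1 f2 | ord.Implies f1 f2 => atoms f1 ++ atoms f2
  | ord.Not f1 => atoms f1
  | _ => [::]
  end.

Lemma qf_eval_sgr r y y' f : rformula f ->
  (forall p, p \in atoms f -> Num.sg p.[y%:P].[r] = Num.sg p.[y'%:P].[r]) ->
  qf_eval [:: r; y] f = qf_eval [:: r; y'] f.
Proof.
have atomE t1 t2 : rterm t1 -> rterm t2 ->
    (forall p, p \in [:: term_poly2 t1 - term_poly2 t2] ->
      Num.sg p.[y%:P].[r] = Num.sg p.[y'%:P].[r]) ->
    Num.sg (eval [:: r; y] t1 - eval [:: r; y] t2) =
    Num.sg (eval [:: r; y'] t1 - eval [:: r; y'] t2).
  move=> rt1 rt2 /(_ _ (mem_head _ _)).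
  by rewrite !(hornerD, hornerN) !term_poly2E.
elim: f => //=.
- move=> t1 t2 /andP[rt1 rt2] /(atomE _ _ rt1 rt2) H.
  by rewrite -subr_eq0 -sgr_eq0 H sgr_eq0 subr_eq0.
- move=> t1 t2 /andP[rt1 rt2] /(atomE _ _ rt1 rt2) H.
  by rewrite -subr_lt0 -sgr_lt0 H sgr_lt0 subr_lt0.
- move=> t1 t2 /andP[rt1 rt2] /(atomE _ _ rt1 rt2) H.
  by rewrite -subr_le0 -sgr_le0 H sgr_le0 subr_le0.
- move=> f1 IH1 f2 IH2 /andP[/IH1{}IH1 /IH2{}IH2] H.
  by rewrite IH1 ?IH2// => p pf; apply: H; rewrite mem_cat pf ?orbT.
- move=> f1 IH1 f2 IH2 /andP[/IH1{}IH1 /IH2{}IH2] H.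
  by rewrite IH1 ?IH2// => p pf; apply: H; rewrite mem_cat pf ?orbT.
- move=> f1 IH1 f2 IH2 /andP[/IH1{}IH1 /IH2{}IH2] H.
  by rewrite IH1 ?IH2// => p pf; apply: H; rewrite mem_cat pf ?orbT.
- by move=> f1 IH1 /IH1{}IH1 /IH1 ->.
Qed.

(** Tarski's quantifier elimination, run on [to_rform f] so that the result contains only the
    inverse-free terms that [term_poly2] translates. *)
Lemma exists_qf f : exists g, rformula g /\
  forall e, holds e f <-> qf_eval e g.
Proof.
exists (quantifier_elim
  (fun i c => qe_rcf.qfr_to_formula (qe_rcf.wproj i c)) (to_rform f)); split.
  have /= := quantifier_elim_wf (@qe_rcf.wf_QE_wproj _) (to_rform_rformula f).
  by case/andP.
by move=> e; apply: rwP; exact: qe_rcf.rcf_satP.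
Qed.

(** The bound d may depend on r in any way; definability turns it into a power of r. Below c r^N no
    nonzero atom vanishes, so a point of the set there could be moved down to arbitrarily small y >
    0 without leaving the set. *)
Lemma definable_lower_bound f :
  (forall r, 0 < r ->
    exists2 d, 0 < d & forall y, 0 < y < d -> ~ holds [:: r; y] f) ->
  exists (r0 c : R) (N : nat), [/\ 0 < r0 <= 1, 0 < c &
    forall r y, 0 < r <= r0 -> 0 < y -> holds [:: r; y] f -> c * r ^+ N <= y].
Proof.
have [g [rg gE]] := exists_qf f.
have [r0 [c [N [r00 c0 H]]]] := roots2_lower_bound (atoms g).
move=> Hf; exists r0, c, N; split=> // r y rr0 y0 /gE gy.
rewrite leNgt; apply/negP => ycr; have /andP[rgt0 _] := rr0.
have [d d0 Hd] := Hf r rgt0.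
pose y' := Num.min (d / 2) y.
have y'0 : 0 < y' by rewrite lt_min divr_gt0.
have y'd : y' < d by rewrite gt_min ltr_pdivrMr// ltr_pMr// ltr1n.
apply: (Hd y'); rewrite ?y'0// gE (_ : qf_eval _ _ = qf_eval [:: r; y] g)//.
apply: qf_eval_sgr => // p pg; apply: sgr_poly2_constant => [|p0 z /andP[yz zy]].
  by rewrite ge_min lexx orbT.
apply/eqP => pz; have := H p r z pg p0 rr0 (lt_le_trans y'0 yz) pz.
by rewrite leNgt (le_lt_trans zy).
Qed.

End FormulaGrowth.

(** * First-order formulas for semialgebraic data *)

Section Encoding.
Import GRing ordered_qelim ordered_qelim.ord.
Variable R : realType.
Implicit Types (e : seq R).

Definition sum_term (I : Type) (s : seq I) (F : I -> term R) : term R :=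
  foldr (fun i => GRing.Add (F i)) (GRing.NatConst R 0) s.

Lemma eval_sum_term (I : Type) (s : seq I) (F : I -> term R) e :
  eval e (sum_term s F) = \sum_(i <- s) eval e (F i).
Proof. by elim: s => [|i s IH]; rewrite ?big_nil ?big_cons //= IH. Qed.

Definition prod_term (I : Type) (s : seq I) (F : I -> term R) : term R :=
  foldr (fun i => GRing.Mul (F i)) (GRing.NatConst R 1) s.

Lemma eval_prod_term (I : Type) (s : seq I) (F : I -> term R) e :
  eval e (prod_term s F) = \prod_(i <- s) eval e (F i).
Proof. by elim: s => [|i s IH]; rewrite ?big_nil ?big_cons //= IH. Qed.

Definition mpoly_term (m : nat) (v : 'I_m -> term R) (p : mpoly.mpoly m R) :=
  sum_term (mpoly.msupp p) (fun u => GRing.Mul (GRing.Const (mpoly.mcoeff u p))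
    (prod_term (enum 'I_m)
      (fun i => GRing.Exp (v i) (mpoly.fun_of_multinom u i)))).

Lemma eval_mpoly_term (m : nat) (v : 'I_m -> term R) (p : mpoly.mpoly m R) e :
  eval e (mpoly_term v p) = peval p (\row_i eval e (v i)).
Proof.
rewrite /peval mpoly.mevalE eval_sum_term; apply: eq_bigr => u _ /=.
rewrite eval_prod_term big_enum/=; congr (_ * _).
by apply: eq_bigr => i _; rewrite mxE.
Qed.

Definition basic_formula (m : nat) (v : 'I_m -> term R)
    (ps qs : seq (mpoly.mpoly m R)) : ord.formula R :=
  ord.And
    (foldr (fun p => ord.And (ord.Equal (mpoly_term v p) (GRing.NatConst R 0)))
      (ord.Bool true) ps)
    (foldr (fun p => ord.And (ord.Lt (GRing.NatConst R 0) (mpoly_term v p)))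
      (ord.Bool true) qs).

Lemma semialgebraic_formula (m : nat) (v : 'I_m -> term R) (A : set 'rV[R]_m) :
  semialgebraic A -> exists g, forall e, holds e g <-> A (\row_i eval e (v i)).
Proof.
move=> [s ->].
exists (foldr (fun c => ord.Or (basic_formula v c.1%PAIR c.2%PAIR))
  (ord.Bool false) s) => e /=.
elim: s => [|[ps qs] s IH] //=; rewrite IH.
have -> : holds e (foldr (fun p =>
    ord.And (ord.Equal (mpoly_term v p) (GRing.NatConst R 0)))
    (ord.Bool true) ps) <-> all (fun p => peval p (\row_i eval e (v i)) == 0) ps.
  elim: ps => [|p ps IHp] //=; rewrite IHp eval_mpoly_term mulr0n.
  by split=> [[/eqP -> ->]//|/andP[/eqP -> ->]].
have -> : holds e (foldr (fun p =>
    ord.And (ord.Lt (GRing.NatConst R 0) (mpoly_term v p)))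
    (ord.Bool true) qs) <-> all (fun p => 0 < peval p (\row_i eval e (v i))) qs.
  elim: qs => [|p qs IHp] //=; rewrite IHp eval_mpoly_term mulr0n.
  by split=> [[-> ->]//|/andP[-> ->]].
by split=> [[/andP ->|->]//|/orP[/andP|]]; [rewrite orbT|left|right].
Qed.

(** The point is read from the n variables starting at k and the value is an arbitrary term, so the
    graph yields formulas for f(x) = t + y, f(x) = t - y and f(a) = t alike. *)
Lemma graph_formula (n : nat) (f : 'rV[R]_n -> R) (k : nat) (u : term R) :
  semialgebraic_fun f ->
  exists g, forall e, holds e g <-> f (\row_(i < n) e`_(k + i)) = eval e u.
Proof.
pose v i := match fintype.split i : 'I_n + 'I_1 with
  inl j => GRing.Var R (k + j) | inr _ => u end.
move=> /(semialgebraic_formula v)[g gE]; exists g => e; rewrite gE /=.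
rewrite (_ : rsubmx _ _ _ = eval e u); last first.
  by rewrite !mxE /v (unsplitK (inr ord0)).
rewrite (_ : lsubmx _ = \row_(i < n) e`_(k + i))//.
by apply/rowP => i; rewrite !mxE /v (unsplitK (inl i)).
Qed.

Definition row_seq (n : nat) (x : 'rV[R]_n) : seq R := [seq x 0 i | i <- enum 'I_n].

Lemma size_row_seq (n : nat) (x : 'rV[R]_n) : size (row_seq x) = n.
Proof. by rewrite size_map size_enum_ord. Qed.

Lemma nth_row_seq (n : nat) (x : 'rV[R]_n) (i : 'I_n) : (row_seq x)`_i = x 0 i.
Proof. by rewrite (nth_map i) ?size_enum_ord// nth_ord_enum. Qed.

(** The bound variables are the first n indices beyond [e], so each quantifier appends one entry to
    the environment. *)
Lemma holds_exists_row (n : nat) (g : ord.formula R) e :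
  holds e (foldr (@ord.Exists R) g (iota (size e) n)) <->
  exists x : 'rV[R]_n, holds (e ++ row_seq x) g.
Proof.
have -> : holds e (foldr (@ord.Exists R) g (iota (size e) n)) <->
    exists2 s, size s = n & holds (e ++ s) g.
  elim: n e => [|n IH] e /=.
    split=> [H|[s /size0nil ->]]; last by rewrite cats0.
    by exists [::]; rewrite ?cats0.
  have E x : holds (set_nth 0 e (size e) x)
      (foldr (@ord.Exists R) g (iota (size e).+1 n)) <->
      exists2 s, size s = n & holds (rcons e x ++ s) g.
    rewrite -IH size_rcons (_ : set_nth _ _ _ _ = rcons e x)//.
    by elim: (e) => //= a e' ->.
  split=> [[x /E[s <- H]]|[[|x s]// [sn] H]].
    by exists (x :: s) => //; rewrite -cat_rcons.
  by exists x; apply/E; exists s => //; rewrite cat_rcons.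
split=> [[s sn H]|[x H]]; last by exists (row_seq x); rewrite ?size_row_seq.
exists (\row_(i < n) s`_i); suff -> : row_seq (\row_(i < n) s`_i) = s by [].
apply: (@eq_from_nth _ 0); rewrite size_row_seq ?sn// => i ni.
by rewrite (nth_row_seq _ (Ordinal ni)) mxE.
Qed.

(** Squares replace norms, the two signs replace the absolute value of f(x) - t, and the clause on
    all a replaces the infimum defining the distance, which makes everything first-order. *)
Lemma distance_value_formula (n : nat) (f : 'rV[R]_n -> R) (t M : R) :
  semialgebraic_fun f -> exists g, forall r y, holds [:: r; y] g <->
    exists x : 'rV[R]_n, [/\ \sum_i x 0 i ^+ 2 <= M ^+ 2,
      f x = t + y \/ f x = t - y &
      forall a, f a = t -> r ^+ 2 <= \sum_i (x - a) 0 i ^+ 2].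
Proof.
move=> fsa.
have [gp gpE] := graph_formula 2
  (GRing.Add (GRing.Const t) (GRing.Var R 1)) fsa.
have [gm gmE] := graph_formula 2
  (GRing.Add (GRing.Const t) (GRing.Opp (GRing.Var R 1))) fsa.
have [ga gaE] := graph_formula (2 + n) (GRing.Const t) fsa.
(* Variables 0 and 1 hold r and y; the next n hold x and the n after those hold a. *)
pose X i := GRing.Var R (2 + i); pose A i := GRing.Var R (2 + n + i).
pose sq (F : nat -> term R) := sum_term (enum 'I_n) (fun i => GRing.Exp (F i) 2).
(* The universal clause is written as a negated existential so that [holds_exists_row] handles both
   quantifier blocks. *)
pose far := ord.Not (foldr (@ord.Exists R) (ord.And ga (ord.Lt
  (sq (fun i => GRing.Add (X i) (GRing.Opp (A i))))
  (GRing.Exp (GRing.Var R 0) 2))) (iota (2 + n) n)).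
pose body := ord.And (ord.Le (sq X) (GRing.Const (M ^+ 2)))
  (ord.And (ord.Or gp gm) far).
have andE e (g h : ord.formula R) :
  holds e (ord.And g h) = (holds e g /\ holds e h) by [].
have ltE e u v : holds e (ord.Lt u v) = (eval e u < eval e v) by [].
have leE e u v : holds e (ord.Le u v) = (eval e u <= eval e v) by [].
have orE e (g h : ord.formula R) :
  holds e (ord.Or g h) = (holds e g \/ holds e h) by [].
have notE e (g : ord.formula R) : holds e (ord.Not g) = ~ holds e g by [].
have sqE F e : eval e (sq F) = \sum_(i < n) eval e (F i) ^+ 2.
  by rewrite eval_sum_term big_enum.
have XE (x : 'rV[R]_n) e s : size e = 2%N -> forall i : 'I_n,
    ((e ++ row_seq x) ++ s)`_(2 + i) = x 0 i.
  move=> se i; rewrite -catA nth_cat se ltnNge leq_addr/= addKn nth_cat.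
  by rewrite size_row_seq ltn_ord nth_row_seq.
have AE (a : 'rV[R]_n) e : size e = (2 + n)%N -> forall i : 'I_n,
    (e ++ row_seq a)`_(2 + n + i) = a 0 i.
  by move=> se i; rewrite nth_cat se ltnNge leq_addr/= addKn nth_row_seq.
have farE r y (x : 'rV[R]_n) : holds ([:: r; y] ++ row_seq x) far <->
    forall a, f a = t -> r ^+ 2 <= \sum_i (x - a) 0 i ^+ 2.
  have se : (2 + n)%N = size ([:: r; y] ++ row_seq x).
    by rewrite size_cat size_row_seq.
  have E (a : 'rV[R]_n) : holds (([:: r; y] ++ row_seq x) ++ row_seq a)
      (ord.And ga (ord.Lt (sq (fun i => GRing.Add (X i) (GRing.Opp (A i))))
      (GRing.Exp (GRing.Var R 0) 2))) <->
      f a = t /\ \sum_i (x - a) 0 i ^+ 2 < r ^+ 2.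
    rewrite andE ltE gaE sqE [eval _ (GRing.Exp _ _)]/= [eval _ (GRing.Const _)]/=.
    rewrite (_ : \row_i _ = a); last by apply/rowP => i; rewrite mxE AE.
    rewrite (eq_bigr (fun i => (x - a) 0 i ^+ 2))// => i _.
    by rewrite !mxE -(AE a _ (esym se) i) -(XE x [:: r; y] (row_seq a) erefl i).
  rewrite /far notE se holds_exists_row.
  split=> [H a fa|H [a /E[/H]]]; last by rewrite leNgt => /negbTE ->.
  by rewrite leNgt; apply/negP => lt_r; apply: H; exists a; apply/E.
exists (foldr (@ord.Exists R) body (iota 2 n)) => r y.
rewrite -[2%N]/(size [:: r; y]) holds_exists_row.
suff E (x : 'rV[R]_n) : holds ([:: r; y] ++ row_seq x) body <->
    [/\ \sum_i x 0 i ^+ 2 <= M ^+ 2, f x = t + y \/ f x = t - y &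
      forall a, f a = t -> r ^+ 2 <= \sum_i (x - a) 0 i ^+ 2].
  by split=> -[x /E H]; exists x.
rewrite !andE orE leE.
have rowE : \row_(i < n) ([:: r; y] ++ row_seq x)`_(2 + i) = x.
  by apply/rowP => i; rewrite mxE -[_ ++ _]cats0 XE.
rewrite sqE gpE gmE farE rowE.
rewrite (eq_bigr (fun i => x 0 i ^+ 2)); first by split=> [[? []]|[]].
by move=> i _; rewrite -(XE x [:: r; y] [::] erefl i) cats0.
Qed.

End Encoding.

(** * Euclidean norm, compactness of balls, and distance to a set *)

Section EuclideanNorm.
Variables (R : realType) (n : nat).
Implicit Types (x y z : 'rV[R]_n).

Lemma enorm_ge0 x : 0 <= enorm x.
Proof. exact: sqrtr_ge0. Qed.

Lemma sum_sqr_ge0 x : 0 <= \sum_i x 0 i ^+ 2.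
Proof. by apply: sumr_ge0 => i _; exact: sqr_ge0. Qed.

Lemma sqr_enorm x : enorm x ^+ 2 = \sum_i x 0 i ^+ 2.
Proof. by rewrite sqr_sqrtr// sum_sqr_ge0. Qed.

Lemma enormZ (a : R) x : enorm (a *: x) = `|a| * enorm x.
Proof.
rewrite /enorm -sqrtr_sqr -sqrtrM ?sqr_ge0// mulr_sumr.
by congr Num.sqrt; apply: eq_bigr => i _; rewrite mxE exprMn.
Qed.

Lemma enormN x : enorm (- x) = enorm x.
Proof. by rewrite -scaleN1r enormZ normrN1 mul1r. Qed.

Lemma enormBC x y : enorm (x - y) = enorm (y - x).
Proof. by rewrite -enormN opprB. Qed.

Lemma enorm0 : enorm (0 : 'rV[R]_n) = 0.
Proof. by rewrite -(scale0r 0) enormZ normr0 mul0r. Qed.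

Lemma le_coord_enorm x i : `|x 0 i| <= enorm x.
Proof.
rewrite -sqrtr_sqr ler_wsqrtr// (bigD1 i)//= lerDl.
by apply: sumr_ge0 => j _; exact: sqr_ge0.
Qed.

(** With P the inner product and S, T the squared norms, the nonnegative sum of the (T x_i - P
    y_i)^2 equals T (S T - P^2); the case T = 0 is treated apart. *)
Lemma cauchy_schwarz x y : \sum_i x 0 i * y 0 i <= enorm x * enorm y.
Proof.
have [y0|y0] := eqVneq (enorm y) 0.
  rewrite y0 mulr0 big1// => i _.
  have /eqP -> : y 0 i == 0 by rewrite -normr_le0 -y0 le_coord_enorm.
  by rewrite mulr0.
have T0 : 0 < enorm y by rewrite lt_neqAle eq_sym y0 enorm_ge0.
set P := \sum_i _; apply: le_trans (ler_norm _) _.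
rewrite -ler_sqr ?nnegrE ?mulr_ge0 ?enorm_ge0// real_normK ?num_real//.
rewrite exprMn; set S := enorm x ^+ 2; set T := enorm y ^+ 2.
have Tgt0 : 0 < T by rewrite exprn_gt0.
have : 0 <= \sum_i (T * x 0 i - P * y 0 i) ^+ 2.
  by apply: sumr_ge0 => i _; exact: sqr_ge0.
have -> : \sum_i (T * x 0 i - P * y 0 i) ^+ 2 = T * (S * T - P ^+ 2).
  rewrite (eq_bigr (fun i => T ^+ 2 * x 0 i ^+ 2 +
    (- (T * P *+ 2)) * (x 0 i * y 0 i) + P ^+ 2 * y 0 i ^+ 2)); last first.
    by move=> i _; ring.
  rewrite !big_split/= -!mulr_sumr -!sqr_enorm -/S -/T -/P; ring.
by rewrite pmulr_rge0// subr_ge0.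
Qed.

Lemma enormD x y : enorm (x + y) <= enorm x + enorm y.
Proof.
rewrite -ler_sqr ?nnegrE ?addr_ge0 ?enorm_ge0//.
rewrite sqrrD !sqr_enorm.
have -> : \sum_i (x + y) 0 i ^+ 2 = \sum_i x 0 i ^+ 2 +
    (\sum_i x 0 i * y 0 i) *+ 2 + \sum_i y 0 i ^+ 2.
  rewrite -sumrMnl -!big_split; apply: eq_bigr => i _ /=.
  by rewrite mxE sqrrD.
by rewrite lerD2r lerD2l lerMn2r cauchy_schwarz.
Qed.

Lemma continuous_enorm : continuous (@enorm R n).
Proof.
suff H (s : seq 'I_n) : continuous (fun z : 'rV[R]_n => \sum_(i <- s) z 0 i ^+ 2).
  by move=> x; apply: continuous_comp; [exact: H|exact: sqrt_continuous].
elim: s => [|i s IH].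
  rewrite (_ : (fun _ => _) = cst (0 : R)); first exact: cst_continuous.
  by apply/funext => z; rewrite big_nil.
rewrite (_ : (fun _ => _) =
    (fun z : 'rV[R]_n => z 0 i * z 0 i) \+ (fun z => \sum_(j <- s) z 0 j ^+ 2)).
  move=> x; apply: continuousD; last exact: IH.
  by apply: continuousM; exact: coord_continuous.
by apply/funext => z; rewrite big_cons.
Qed.

Lemma continuous_enormB x : continuous (fun z => enorm (z - x)).
Proof.
move=> z; apply: (@continuous_comp _ _ _ (fun z => z - x)).
  by apply: (@continuousB _ _ _ id (cst x)) => //; exact: cst_continuous.
exact: continuous_enorm.
Qed.

Lemma closed_enormB_le x (r : R) : closed [set z | enorm (z - x) <= r].
Proof.
apply: (@closed_comp _ _ (fun z => enorm (z - x)) [set y | y <= r]).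
  by move=> z _; exact: continuous_enormB.
exact: closed_le.
Qed.

Lemma closed_enormB_ge x (r : R) : closed [set z | r <= enorm (z - x)].
Proof.
apply: (@closed_comp _ _ (fun z => enorm (z - x)) [set y | r <= y]).
  by move=> z _; exact: continuous_enormB.
exact: closed_ge.
Qed.

(** The Euclidean ball is a closed subset of a product of segments. *)
Lemma compact_enormB_le x (r : R) : compact [set z | enorm (z - x) <= r].
Proof.
apply: (@subclosed_compact _ _
    [set z : 'rV[R]_n | forall i, `[x 0 i - r, x 0 i + r]%classic (z ord0 i)]).
- exact: closed_enormB_le.
- apply: (@rV_compact _ _ (fun i => `[x 0 i - r, x 0 i + r]%classic)) => i.
  exact: segment_compact.
- move=> z /= zr i; have := le_trans (le_coord_enorm (z - x) i) zr.
  by rewrite in_itv/= !mxE ler_distl.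
Qed.

Lemma dist_to_le x (A : set 'rV[R]_n) a : A a -> dist_to x A <= enorm (x - a).
Proof.
move=> Aa; rewrite /dist_to asboolT; last by exists a.
apply: ge_inf; last by exists a.
by exists 0 => _ [b _ <-]; exact: enorm_ge0.
Qed.

Lemma dist_to_empty x : dist_to x set0 = 1.
Proof. by rewrite /dist_to asboolF// => -[]. Qed.

End EuclideanNorm.

(** * Descent along the gradient and nearby points of the fibre *)

Section Gradient.
Variables (R : realType) (n : nat).
Implicit Types (f : 'rV[R]_n -> R) (x z v : 'rV[R]_n).

Lemma derive_gradient f x v : differentiable f x ->
  'D_v f x = \sum_i v 0 i * gradient f x 0 i.
Proof.
move=> df; rewrite deriveE// {1}(row_sum_delta v) linear_sum/=.
by apply: eq_bigr => i _; rewrite linearZ/= mxE deriveE.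
Qed.

(** Here s stands for the sign of f(z) - t. A step h along - s grad f(z) lowers s (f - t) by about h
    N^2 and has length h N, where N is the gradient norm; as lambda < N, the gain exceeds lambda
    times the length. *)
Lemma gradient_descent f (s t : R) z (lambda e : R) :
  differentiable f z -> `|s| = 1 -> 0 < s * (f z - t) ->
  0 < lambda < enorm (gradient f z) -> 0 < e ->
  exists w, [/\ enorm (w - z) < e, 0 < s * (f w - t) &
    s * (f w - t) + lambda * enorm (w - z) < s * (f z - t)].
Proof.
move=> df s1 fz0 /andP[l0 lG] e0.
set G := gradient f z in lG *; set N := enorm G in lG *.
have N0 : 0 < N by exact: lt_trans lG.
have ss : s * s = 1 by rewrite -expr2 -[s ^+ 2]real_normK ?num_real// s1 expr1n.
pose v := - s *: G.
have dv : 'D_v f z = - s * N ^+ 2.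
  rewrite derive_gradient// sqr_enorm mulr_sumr; apply: eq_bigr => i _.
  by rewrite mxE -mulrA.
pose q (h : R) : R := h^-1 * (f (h *: v + z) - f z).
have cq : q @ 0^'+ --> - s * N ^+ 2.
  by apply: cvg_dnbhs_at_right; rewrite -dv; exact: (diff_derivable df).
have csq : (fun h => s * q h) @ 0^'+ --> - N ^+ 2.
  have -> : - N ^+ 2 = s * (- s * N ^+ 2) by rewrite mulrA mulrN ss mulN1r.
  by apply: cvgM; [exact: cvg_cst|exact: cq].
have q1 : \forall h \near (0 : R)^'+, s * q h < - (lambda * N).
  by apply: (cvgr_lt _ csq); rewrite ltrN2 expr2 ltr_pM2r.
(* Together with [q4], this keeps [s * (f w - t)] positive, so that the step does not cross the
   fibre; [q3] keeps its length below [e]. *)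
have q2 : \forall h \near (0 : R)^'+, s * q h > - (N ^+ 2 + 1).
  by apply: (cvgr_gt _ csq); rewrite ltrN2 ltrDl.
have q3 : \forall h \near (0 : R)^'+, h < e / N.
  by apply: nbhs_right_lt; rewrite divr_gt0.
have q4 : \forall h \near (0 : R)^'+, h < s * (f z - t) / (N ^+ 2 + 1).
  by apply: nbhs_right_lt; rewrite divr_gt0// addr_gt0// exprn_gt0.
have q5 : \forall h \near (0 : R)^'+, 0 < h by exact: nbhs_right_gt.
have [h [h1 h2 h3 h4 h5]] : exists h : R, [/\ s * q h < - (lambda * N),
    s * q h > - (N ^+ 2 + 1), h < e / N, h < s * (f z - t) / (N ^+ 2 + 1) & 0 < h].
  by near (0 : R)^'+ => h; exists h; split; near: h.
have fw : s * (f (h *: v + z) - t) = s * (f z - t) + h * (s * q h).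
  by rewrite /q; field; rewrite gt_eqF.
have vN : enorm v = N by rewrite enormZ normrN s1 mul1r.
exists (h *: v + z); rewrite addrK enormZ vN gtr0_norm// fw; split.
- by rewrite -ltr_pdivlMr.
- rewrite ltr_pdivlMr in h4; last by rewrite addr_gt0// exprn_gt0.
  rewrite -(ltr_pM2l h5) in h2; move: h2 h4; lra.
- by rewrite -(ltr_pM2l h5) in h1; move: h1; lra.
Unshelve. all: end_near. Qed.

Lemma continuous_normB f (t : R) :
  continuous f -> continuous (fun z => `|f z - t|).
Proof.
move=> cf z; apply: (@continuous_comp _ _ _ (fun z => f z - t) Num.norm).
  by apply: continuousB; [exact: cf|exact: cst_continuous].
exact: norm_continuous.
Qed.

(** As in Ekeland's variational principle, comparing the minimiser z with x gives lambda ||z - x||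
    <= |f(x) - t| < lambda rho, so z is interior and a descent step from z stays in the ball. *)
Lemma fiber_point_near f (t lambda rho : R) x :
  (forall z, differentiable f z) -> 0 < lambda -> `|f x - t| < lambda * rho ->
  (forall z, enorm (z - x) <= rho -> 0 < `|f z - t| <= `|f x - t| ->
    lambda < enorm (gradient f z)) ->
  exists2 a, f a = t & lambda * enorm (x - a) <= `|f x - t|.
Proof.
move=> df l0 xrho H; have rho0 : 0 < rho.
  by rewrite -(pmulr_rgt0 _ l0) (le_lt_trans _ xrho).
have cg : continuous (fun z => `|f z - t| + lambda * enorm (z - x)).
  move=> z; apply: (@continuousD _ _ _ (fun z => `|f z - t|)
      (fun z => lambda * enorm (z - x))).
    apply: continuous_normB => {}z; exact: differentiable_continuous.
  by apply: (@continuousM _ _ (cst lambda) (fun z => enorm (z - x)));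
    [exact: cst_continuous|exact: continuous_enormB].
have ball0 : [set z | enorm (z - x) <= rho] !=set0.
  by exists x; rewrite /= subrr enorm0 ltW.
have [z zB zmin] := EVT_min_rV ball0 (@compact_enormB_le _ _ x rho)
  (continuous_subspaceT cg).
move: zB; rewrite inE/= => zB.
have zx : `|f z - t| + lambda * enorm (z - x) <= `|f x - t|.
  have := zmin x; rewrite inE/= subrr enorm0 mulr0 addr0; apply; exact: ltW.
have zx' : lambda * enorm (z - x) <= `|f x - t|.
  by rewrite (le_trans _ zx)// lerDr.
have [fzt|fzt] := eqVneq (f z) t.
  by exists z => //; rewrite enormBC.
exfalso.
have fz0 : 0 < `|f z - t| by rewrite normr_gt0 subr_eq0.
have zint : enorm (z - x) < rho.
  by rewrite -(ltr_pM2l l0) (le_lt_trans zx').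
have gz : lambda < enorm (gradient f z).
  apply: H => //; rewrite fz0 (le_trans _ zx)// lerDl mulr_ge0 ?enorm_ge0// ltW//.
pose s := Num.sg (f z - t); pose F w := s * (f w - t).
have Fz : F z = `|f z - t| by rewrite /F /s -normrEsg.
have s1 : `|s| = 1 by rewrite normr_sg subr_eq0 fzt.
have [w [wz Fw wlt]] :
  exists w, [/\ enorm (w - z) < rho - enorm (z - x), 0 < F w &
    F w + lambda * enorm (w - z) < F z].
  by apply: gradient_descent; rewrite -/(F z) ?Fz ?subr_gt0// l0.
have Fwg : F w = `|f w - t|.
  by rewrite -(gtr0_norm Fw) normrM s1 mul1r.
have tri : enorm (w - x) <= enorm (w - z) + enorm (z - x).
  by rewrite (le_trans _ (enormD _ _))// addrA subrK.
have := zmin w; rewrite inE/= => /(_ _).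
have wx : enorm (w - x) <= rho by move: wz tri; lra.
move=> /(_ wx); apply/negP; rewrite -ltNge.
rewrite Fwg Fz in wlt; rewrite -(ler_pM2l l0) in tri.
by move: wlt tri; lra.
Qed.

(** If the bound failed for every r = k + 1 and d = 1 / (k + 1), the counterexamples would form a
    sequence that makes t an asymptotic critical value. *)
Lemma gradient_bound_at_infinity f (t : R) :
  ~ asymptotic_critical_values f t ->
  exists r d : R, [/\ 0 < r, 0 < d & forall x, r <= enorm x -> `|f x - t| <= d ->
    d <= enorm x * enorm (gradient f x)].
Proof.
move=> tK; apply: contrapT => H; apply: tK.
have {}H k : exists x : 'rV[R]_n, [/\ k.+1%:R <= enorm x,
    `|f x - t| <= k.+1%:R^-1 & enorm x * enorm (gradient f x) <= k.+1%:R^-1].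
  apply: contrapT => Hk; apply: H; exists k.+1%:R, k.+1%:R^-1; split=> //.
  move=> x x1 x2; rewrite leNgt; apply/negP => x3; apply: Hk.
  by exists x; split=> //; exact: ltW.
have [u uP] := choice H; exists u.
split.
- apply/cvgryPge => M; near=> k.
  have [+ _ _] := uP k; apply: le_trans.
  rewrite (@le_trans _ _ k%:R) ?ler_nat//.
  by near: k; exact: nbhs_infty_ger.
- apply/cvgrPdist_le => e e0; near=> k.
  have [_ + _] := uP k; rewrite distrC => /le_trans; apply; apply: ltW.
  by near: k; exact: (near_infty_natSinv_lt (PosNum e0)).
- apply/cvgrPdist_le => e e0; near=> k.
  have [_ _ +] := uP k; rewrite sub0r normrN ger0_norm ?mulr_ge0 ?enorm_ge0//.
  move=> /le_trans; apply; apply: ltW.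
  by near: k; exact: (near_infty_natSinv_lt (PosNum e0)).
Unshelve. all: end_near. Qed.

(** Take rho = ||x|| / 2 and lambda = d / (2 ||x||), so that lambda rho = d / 4. On this ball r <=
    ||z|| <= 3 ||x|| / 2, hence the gradient norm is at least 2 d / (3 ||x||) > lambda wherever
    |f(z) - t| <= d. *)
Lemma fiber_point_far f (t r d : R) x : (forall z, differentiable f z) ->
  0 < r -> 0 < d ->
  (forall z, r <= enorm z -> `|f z - t| <= d ->
    d <= enorm z * enorm (gradient f z)) ->
  2 * r <= enorm x -> `|f x - t| < d / 4 ->
  exists2 a, f a = t & d / 2 * enorm (x - a) <= enorm x * `|f x - t|.
Proof.
move=> df r0 d0 H rx fx.
have x0 : 0 < enorm x by rewrite (lt_le_trans _ rx)// mulr_gt0.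
have l0 : 0 < d / 2 / enorm x by rewrite !divr_gt0.
have [|z zx /andP[fz0 fzx]|a fa ax] :=
  @fiber_point_near f t (d / 2 / enorm x) (enorm x / 2) x df l0.
- by rewrite mulrA divfK ?gt_eqF// -mulrA -invfM -natrM.
- have zu : enorm z <= enorm x * (3 / 2).
    have := enormD (z - x) x; rewrite subrK; move: zx; lra.
  have zl : enorm x / 2 <= enorm z.
    have := enormD (x - z) z; rewrite subrK enormBC; move: zx; lra.
  have z0 : 0 < enorm z by rewrite (lt_le_trans _ zl)// divr_gt0.
  have rz : r <= enorm z by move: zl rx; lra.
  have fzd : `|f z - t| <= d by move: fzx fx d0; lra.
  have {rz fzd} := H z rz fzd.
  rewrite ltr_pdivrMr//; have := enorm_ge0 (gradient f z).
  move: (enorm (gradient f z)) => g g0 dg.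
  have : enorm z * g <= enorm x * (3 / 2) * g by rewrite ler_wpM2r.
  move: dg d0; set w := enorm x; set u := enorm z; lra.
- by exists a => //; rewrite -ler_pdivrMl// mulrCA mulrA in ax *.
Qed.

End Gradient.

(** * Lojasiewicz inequality on a ball *)

Section Lojasiewicz.
Import ordered_qelim.ord.
Variables (R : realType) (n : nat).
Implicit Types (f : 'rV[R]_n -> R) (x : 'rV[R]_n).

Lemma dist_to_ge0 x (A : set 'rV[R]_n) : 0 <= dist_to x A.
Proof.
rewrite /dist_to; case: asboolP => // -[a Aa].
apply: lb_le_inf; first by exists (enorm (x - a)); exists a.
by move=> _ [b _ <-]; exact: enorm_ge0.
Qed.

Lemma lojasiewicz_ball f (t M : R) : continuous f -> semialgebraic_fun f ->
  0 <= M -> [set y | f y = t] !=set0 ->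
  exists (c : R) (N : nat), 0 < c /\ forall x, enorm x <= M ->
    c * dist_to x [set y | f y = t] ^+ N.+1 <= `|f x - t|.
Proof.
move=> cf fsa M0 [a0 fa0].
have [g gE] := distance_value_formula t M fsa.
have sqr_le (u : R) x : 0 <= u -> u ^+ 2 <= \sum_i x 0 i ^+ 2 <-> u <= enorm x.
  by move=> u0; rewrite -sqr_enorm ler_sqr ?nnegrE ?enorm_ge0.
have sqr_ge x : \sum_i x 0 i ^+ 2 <= M ^+ 2 <-> enorm x <= M.
  by rewrite -sqr_enorm ler_sqr ?nnegrE ?enorm_ge0.
have [|r0 [c [N [/andP[r00 r01] c0 H]]]] := @definable_lower_bound _ g.
  move=> r rgt0.
  (* On this compact set, which avoids the fibre, |f - t| has a positive minimum, and that is the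
     required d; if the set is empty, any d will do. *)
  pose K := [set x | enorm (x - 0) <= M] `&`
    \bigcap_(a in [set y | f y = t]) [set x | r <= enorm (x - a)].
  have cK : compact K.
    apply: subclosed_compact (@compact_enormB_le _ _ 0 M) _; last by move=> x [].
    apply: closedI; first exact: closed_enormB_le.
    by apply: closed_bigI => a _; exact: closed_enormB_ge.
  have KP y : 0 < y -> holds [:: r; y] g -> exists2 x, K x & `|f x - t| = y.
    move=> y0 /gE[z [/sqr_ge zM fz zfar]]; exists z.
      split=> /=; first by rewrite subr0.
      by move=> a /zfar/sqr_le; apply; exact: ltW.
    by case: fz => ->; rewrite [X in X - t]addrC addrK ?normrN gtr0_norm.
  have [K0|/set0P/negP/negPn/eqP K0] := pselect (K !=set0); last first.
    exists 1 => // y /andP[y0 _] /(KP _ y0)[x]; by rewrite K0.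
  have [x0] := EVT_min_rV K0 cK (continuous_subspaceT (continuous_normB (t := t) cf)).
  rewrite inE => -[_ x0far] x0min; exists `|f x0 - t|.
    rewrite normr_gt0 subr_eq0; apply/eqP => fx0.
    by have := x0far x0 fx0; rewrite /= subrr enorm0 leNgt rgt0.
  move=> y /andP[y0 yx0] /(KP _ y0)[x Kx fxy].
  have := x0min x; rewrite inE => /(_ Kx).
  by rewrite fxy leNgt yx0.
set V := [set y | f y = t].
(* [D] bounds the distance to the fibre on the ball, so r = (r0 / D) dist(x, V) stays within (0,
   r0]; as r0 <= 1 <= D, r is also at most the distance. *)
pose D := M + enorm a0 + 1.
have D1 : 1 <= D by rewrite lerDr addr_ge0 ?enorm_ge0.
have D0 : 0 < D by exact: lt_le_trans D1.
exists (c * (r0 / D) ^+ N.+1), N; split.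
  by rewrite mulr_gt0// exprn_gt0// divr_gt0.
move=> x xM; rewrite -mulrA -exprMn.
have := dist_to_ge0 x V; rewrite le_eqVlt => /predU1P[<-|dx].
  by rewrite mulr0 expr0n/= mulr0.
have fxt : f x != t.
  apply/eqP => /(@dist_to_le _ _ x V); rewrite subrr enorm0.
  by rewrite leNgt dx.
have dxD : dist_to x V <= D.
  rewrite (le_trans (dist_to_le x fa0))// (le_trans (enormD _ _))// enormN.
  by rewrite /D; move: xM; lra.
set r := r0 / D * dist_to x V.
have r_gt0 : 0 < r by rewrite !mulr_gt0// invr_gt0.
have rr0 : r <= r0.
  by rewrite /r -mulrA ler_piMr ?(ltW r00)// ler_pdivrMl// mulr1.
have rdx : r <= dist_to x V.
  rewrite ler_piMl ?(ltW dx)// ler_pdivrMr// mul1r; exact: le_trans D1.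
have : c * r ^+ N <= `|f x - t|.
  apply: H; rewrite ?r_gt0// ?normr_gt0 ?subr_eq0//.
  apply/gE; exists x; split; first exact/sqr_ge.
    by have [_|_] := ger0P (f x - t); [left|right]; ring.
  move=> a fa; apply/sqr_le; first exact: ltW.
  by rewrite (le_trans rdx)// dist_to_le.
(* As r <= 1, the exponent may be raised from N to N + 1, which is positive and hence has an
   inverse. *)
apply: le_trans; rewrite ler_wpM2l ?(ltW c0)//.
by rewrite exprSr ler_piMr ?exprn_ge0 ?(ltW r_gt0)// (le_trans rr0).
Qed.

(** Taking roots makes the Lojasiewicz bound linear in the distance, with alpha = 1 / (N + 1). *)
Lemma powR_root_le (c d y : R) (N : nat) : 0 <= c -> 0 <= d ->
  c * d ^+ N.+1 <= y -> c `^ N.+1%:R^-1 * d <= y `^ N.+1%:R^-1.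
Proof.
move=> c0 d0 cdy.
have dE : d = (d ^+ N.+1) `^ N.+1%:R^-1.
  by rewrite -powR_mulrn// -powRrM mulfV ?powRr1// pnatr_eq0.
rewrite {1}dE -powRM ?exprn_ge0//; apply: ge0_ler_powR => //.
  by rewrite nnegrE mulr_ge0// exprn_ge0.
by rewrite nnegrE (le_trans _ cdy)// mulr_ge0// exprn_ge0.
Qed.

End Lojasiewicz.

(** * Combination of the estimates inside and outside the ball *)

Theorem theorem1p1 (R : realType) (n : nat) (f : 'rV[R]_n -> R) (t : R)
    (fC1 : C1 f) (fsa : semialgebraic_fun f)
    (tK : ~ asymptotic_critical_values f t) :
  exists alpha c : R, [/\ 0 < alpha, 0 < c &
    forall x : 'rV[R]_n,
      `|f x - t| `^ alpha + enorm x * `|f x - t|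
        >= c * dist_to x [set y | f y = t]].
Proof.
have [df _] := fC1.
have cf : continuous f by move=> x; exact: differentiable_continuous.
have [r [d [r0 d0 H]]] := gradient_bound_at_infinity tK.
have far x : 2 * r <= enorm x -> `|f x - t| < d / 4 ->
  exists2 a, f a = t & d / 2 * enorm (x - a) <= enorm x * `|f x - t|.
  exact: fiber_point_far.
set V := [set y | f y = t].
have [V0|V0] := pselect (V !=set0); last first.
  have fV x : 0 < `|f x - t|.
    by rewrite normr_gt0 subr_eq0; apply/eqP => fx; apply: V0; exists x.
  have [|x0 _ x0min] := EVT_min_rV _ (@compact_enormB_le R n 0 (2 * r))
      (continuous_subspaceT (continuous_normB (t := t) cf)).
    by exists 0; rewrite /= subrr enorm0 mulr_ge0// ltW.
  (* For an empty fibre the distance is 1, so a positive lower bound for |f - t| suffices: its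
     minimum on the ball, and d / 4 outside, where a smaller value would produce a point of the
     fibre. *)
  exists 1, (Num.min (d / 4) `|f x0 - t|); split=> //.
    by rewrite lt_min fV divr_gt0.
  move=> x; have -> : V = set0 by apply/eqP/negPn/negP => /set0P.
  rewrite dist_to_empty mulr1 powRr1//.
  apply: (@le_trans _ _ `|f x - t|); last by rewrite lerDl mulr_ge0 ?enorm_ge0.
  rewrite ge_min; have [xr|/ltW xr] := leP (enorm x) (2 * r).
    by apply/orP; right; apply: x0min; rewrite inE /= subr0.
  apply/orP; left; rewrite leNgt; apply/negP => /(far x xr)[a fa _].
  by apply: V0; exists a.
(* The extra 1 in the radius ensures ||x|| >= 1 outside the ball. *)
have [|c [N [c0 near0]]] := @lojasiewicz_ball R n f t (2 * r + 1) cf fsa _ V0.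
  by rewrite addr_ge0// mulr_ge0// ltW.
have [a0 fa0] := V0.
have a0_gt0 : 0 < 1 + enorm a0 by rewrite ltr_pwDl// enorm_ge0.
have cR0 : 0 < c `^ N.+1%:R^-1 by rewrite powR_gt0.
(* The three constants serve the ball, the strip |f - t| < d / 4 outside it, and the rest. *)
exists N.+1%:R^-1, (Num.min (c `^ N.+1%:R^-1)
  (Num.min (d / 2) (d / 4 / (1 + enorm a0)))).
split; [by rewrite invr_gt0 ltr0n|by rewrite !lt_min cR0 !divr_gt0|move=> x].
set m := Num.min _ _.
have mle u : m <= u -> m * dist_to x V <= u * dist_to x V.
  by move=> mu; rewrite ler_wpM2r// dist_to_ge0.
have [xr|xr] := leP (enorm x) (2 * r + 1).
  rewrite (le_trans (mle (c `^ N.+1%:R^-1) _)) ?ge_min ?lexx//.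
  rewrite (le_trans (powR_root_le (ltW c0) (dist_to_ge0 x V) (near0 x xr)))//.
  by rewrite lerDl mulr_ge0 ?enorm_ge0.
suff : m * dist_to x V <= enorm x * `|f x - t|.
  by move=> /le_trans; apply; rewrite lerDr powR_ge0.
have xr2 : 2 * r <= enorm x by move: xr; lra.
have [fx|fx] := ltP `|f x - t| (d / 4).
  have [a fa ax] := far x xr2 fx.
  rewrite (le_trans (mle (d / 2) _)) ?ge_min ?lexx ?orbT//.
  by rewrite (le_trans _ ax)// ler_pM2l ?divr_gt0// dist_to_le.
(* Off the strip, dist(x, V) <= ||x|| + ||a0|| <= (1 + ||a0||) ||x|| because ||x|| >= 1. *)
rewrite (le_trans (mle (d / 4 / (1 + enorm a0)) _)) ?ge_min ?lexx ?orbT//.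
apply: (@le_trans _ _ (enorm x * (d / 4))); last by rewrite ler_wpM2l ?enorm_ge0.
rewrite mulrAC ler_pdivrMr// [enorm x * (d / 4)]mulrC -[leRHS]mulrA.
rewrite ler_wpM2l ?divr_ge0 ?(ltW d0)//.
rewrite (le_trans (dist_to_le x fa0))// (le_trans (enormD _ _))// enormN.
rewrite mulrDr mulr1 lerD2l ler_peMl ?enorm_ge0//.
by move: xr r0; lra.
Qed.
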